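(* Let $s>0$. There exists $I_s':\mathcal{P}\to\mathcal{P}$ such that $$(E'+s\,\mathbf{id})I_s'=\mathbf{id}=I_s'(E'+s\,\mathbf{id}).$$
   Context: Let $n\ge 1$ and let $\mathbb{R}[\underline{x}]$ be the ring of real polynomials in $\underline{x}=(x_1,\ldots,x_n)$. A linear operator on $\mathbb{R}[\underline{x}]$ is shift-invariant if it commutes with all translations $f(\underline{x})\mapsto f(\underline{x}+\underline{y})$. A multivariate delta operator is a tuple $(O_{x_1},\ldots,O_{x_n})$ of shift-invariant linear operators on $\mathbb{R}[\underline{x}]$ for which there is a constant $c\ne0$ with $O_{x_j}(x_k)=c\,\delta_{jk}$ for all $j,k$. Fix such a tuple, together with linear operators $x_1',\ldots,x_n'$ on $\mathbb{R}[\underline{x}]$ satisfying the Weyl--Heisenberg relations $[O_{x_j},O_{x_k}]=0=[x_j',x_k']$, $[O_{x_j},x_k']=\delta_{jk}\mathbf{id}$, where $[a,b]=ab-ba$. The polynomials $V_\alpha=(x_1')^{\alpha_1}\cdots(x_n')^{\alpha_n}\mathbf{1}$, $\alpha\in\mathbb{N}_0^n$, form a basis of $\mathbb{R}[\underline{x}]$ with $O_{x_j}V_\alpha=\alpha_jV_{\alpha-\mathbf{v}_j}$ and $x_j'V_\alpha=V_{\alpha+\mathbf{v}_j}$ ($\mathbf{v}_j$ the $j$-th standard basis vector). Let $C\ell_{0,n}$ be the real Clifford algebra generated by $\mathbf{e}_1,\ldots,\mathbf{e}_n$ with $\mathbf{e}_j\mathbf{e}_k+\mathbf{e}_k\mathbf{e}_j=-2\delta_{jk}$,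 and $\mathcal{P}=\mathbb{R}[\underline{x}]\otimes C\ell_{0,n}$ (Clifford-valued polynomials). The operators $O_{x_j},x_j'$ act on the polynomial factor. Put $E'=\sum_{j=1}^nx_j'O_{x_j}$ (umbral Euler operator), a linear operator on $\mathcal{P}$. *)

(* Defs.v *)
From HB Require Import structures.
From mathcomp Require Import all_boot all_order all_algebra.
From mathcomp Require Import reals.
From mathcomp Require Import ssrcomplements mpoly.
From mathcomp Require Import ring.

Set Implicit Arguments.
Unset Strict Implicit.
Unset Printing Implicit Defensive.

Import Order.TTheory GRing.Theory Num.Theory.
Local Open Scope ring_scope.

Section Clifford.
Context (R : comNzRingType) (n : nat).
Implicit Types (A B C : {set 'I_n}).

(* The Clifford algebra of signature (0, n): the free R-module on the blades
   e_A = e_{i_1} ... e_{i_k}, where A = {i_1 < ... < i_k} ranges over the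
   subsets of the index set. *)
Definition clifford : Type := {ffun {set 'I_n} -> R^o}.

HB.instance Definition _ := GRing.Lmodule.on clifford.

Definition sdiff A B : {set 'I_n} := [set i | (i \in A) (+) (i \in B)].

(* e_A e_B = csign A B *: e_(sdiff A B): a factor -1 for each pair i in A,
   j in B with j < i (e_i and e_j anticommute), and one for each i = j
   (e_i ^+ 2 = -1). *)
Definition csign A B : R :=
  \prod_(i in A) \prod_(j in B) (-1) ^+ (j <= i)%N.

Definition clifford_mul (a b : clifford) : clifford :=
  [ffun C => \sum_A csign A (sdiff A C) * (a A * b (sdiff A C))].

Definition blade A : clifford := [ffun B => (B == A)%:R].

Lemma sdiffA A B C : sdiff A (sdiff B C) = sdiff (sdiff A B) C.
Proof. by apply/setP => i; rewrite !inE addbA. Qed.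

Lemma sdiffC A B : sdiff A B = sdiff B A.
Proof. by apply/setP => i; rewrite !inE addbC. Qed.

Lemma sdiffK A : cancel (sdiff A) (sdiff A).
Proof. by move=> B; apply/setP => i; rewrite !inE addKb. Qed.

Lemma sdiff0 A : sdiff set0 A = A.
Proof. by apply/setP => i; rewrite !inE. Qed.

Lemma sdiffv A : sdiff A A = set0.
Proof. by apply/setP => i; rewrite !inE addbb. Qed.

Lemma big_sdiff (F : 'I_n -> R) A B :
  (forall i, F i * F i = 1) ->
  \prod_(i in sdiff A B) F i = (\prod_(i in A) F i) * (\prod_(i in B) F i).
Proof.
move=> FF; rewrite [LHS]big_mkcond [X in X * _]big_mkcond [X in _ * X]big_mkcond.
rewrite -big_split; apply: eq_bigr => i _ /=; rewrite inE.
by case: (i \in A); case: (i \in B); rewrite /= ?mul1r ?mulr1 ?FF.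
Qed.

Lemma csignDl A B C : csign (sdiff A B) C = csign A C * csign B C.
Proof.
apply: big_sdiff => i; rewrite -big_split big1 // => j _ /=.
by rewrite -expr2 sqrr_sign.
Qed.

Lemma csignDr A B C : csign A (sdiff B C) = csign A B * csign A C.
Proof.
rewrite /csign -big_split; apply: eq_bigr => i _ /=.
by apply: big_sdiff => j; rewrite -expr2 sqrr_sign.
Qed.

Lemma csign0l A : csign set0 A = 1.
Proof. by rewrite /csign big_set0. Qed.

Lemma csign0r A : csign A set0 = 1.
Proof. by rewrite /csign big1 // => i _; rewrite big_set0. Qed.

Lemma clifford_mulA : associative clifford_mul.
Proof.
move=> a b c; apply/ffunP => D; rewrite !ffunE.
under eq_bigr => A _ do rewrite ffunE !mulr_sumr.
under [RHS]eq_bigr => E _ do rewrite ffunE mulr_suml mulr_sumr.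
rewrite [RHS]exchange_big /=; apply: eq_bigr => A _.
rewrite [RHS](reindex_inj (can_inj (sdiffK A))) /=; apply: eq_bigr => B _.
have -> : sdiff B (sdiff A D) = sdiff (sdiff A B) D.
  by rewrite sdiffA (sdiffC B).
rewrite sdiffK; set C := sdiff (sdiff A B) D.
have -> : sdiff A D = sdiff B C by rewrite /C (sdiffC A B) -sdiffA sdiffK.
rewrite csignDl csignDr.
ring.
Qed.

Lemma clifford_mul1l : left_id (blade set0) clifford_mul.
Proof.
move=> a; apply/ffunP => C; rewrite !ffunE (bigD1 set0) //= big1 => [|A A0].
  by rewrite ffunE eqxx csign0l sdiff0 !mul1r addr0.
by rewrite ffunE (negPf A0) mul0r mulr0.
Qed.

Lemma clifford_mul1r : right_id (blade set0) clifford_mul.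
Proof.
move=> a; apply/ffunP => C; rewrite !ffunE (bigD1 C) //= big1 => [|A AC].
  by rewrite ffunE sdiffv eqxx csign0r mul1r mulr1 addr0.
rewrite ffunE; case: eqP => [AC0|]; last by rewrite !mulr0.
by case/eqP: AC; rewrite -[RHS](sdiffK A) AC0 sdiffC sdiff0.
Qed.

Lemma clifford_mulDl : left_distributive clifford_mul +%R.
Proof.
move=> a b c; apply/ffunP => C; rewrite !ffunE -big_split.
by apply: eq_bigr => A _; rewrite ffunE mulrDl mulrDr.
Qed.

Lemma clifford_mulDr : right_distributive clifford_mul +%R.
Proof.
move=> a b c; apply/ffunP => C; rewrite !ffunE -big_split.
by apply: eq_bigr => A _; rewrite ffunE !mulrDr.
Qed.

Lemma clifford_1_neq0 : blade set0 != 0.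
Proof. by apply/eqP => /ffunP/(_ set0)/eqP; rewrite !ffunE eqxx oner_eq0. Qed.

HB.instance Definition _ := GRing.Zmodule_isNzRing.Build clifford
  clifford_mulA clifford_mul1l clifford_mul1r
  clifford_mulDl clifford_mulDr clifford_1_neq0.

Lemma clifford_scaleAl (c : R) (a b : clifford) : c *: (a * b) = (c *: a) * b.
Proof.
apply/ffunP => C; rewrite !ffunE scaler_sumr; apply: eq_bigr => A _.
by rewrite ffunE /GRing.scale /=; ring.
Qed.

HB.instance Definition _ :=
  GRing.Lmodule_isLalgebra.Build R clifford clifford_scaleAl.

Lemma clifford_scaleAr (c : R) (a b : clifford) : c *: (a * b) = a * (c *: b).
Proof.
apply/ffunP => C; rewrite !ffunE scaler_sumr; apply: eq_bigr => A _.
by rewrite ffunE /GRing.scale /=; ring.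
Qed.

HB.instance Definition _ :=
  GRing.Lalgebra_isAlgebra.Build R clifford clifford_scaleAr.

Definition clifford_gen (j : 'I_n) : clifford := blade [set j].

Lemma blade_mul A B : blade A * blade B = csign A B *: blade (sdiff A B).
Proof.
apply/ffunP => C; rewrite !ffunE (bigD1 A) //= big1 => [|D DA]; last first.
  by rewrite ffunE (negPf DA) mul0r mulr0.
rewrite !ffunE eqxx addr0 mul1r -(inj_eq (can_inj (sdiffK A))) sdiffK.
by case: eqP => [->|_]; rewrite ?sdiffK // /GRing.scale /= !mulr0.
Qed.

Lemma clifford_genM (j k : 'I_n) :
  clifford_gen j * clifford_gen k + clifford_gen k * clifford_gen j
  = ((-2) *+ (j == k))%:A.
Proof.
rewrite !blade_mul (sdiffC [set k]) /csign !big_set1 -scalerDl.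
case: eqVneq => [->|jk].
  by rewrite sdiffv leqnn mulr1n -opprD.
rewrite mulr0n scale0r; case: ltngtP => [||/val_inj/eqP]; last by rewrite eq_sym (negPf jk).
  by rewrite addrC subrr scale0r.
by rewrite subrr scale0r.
Qed.

Lemma bladeE A : blade A = \prod_(i in A) clifford_gen i.
Proof.
have srt : sorted (fun i j : 'I_n => (i < j)%N) (enum 'I_n).
  by have := iota_ltn_sorted 0 n; rewrite -val_enum_ord sorted_map.
transitivity (\prod_(i <- enum 'I_n | i \in A) clifford_gen i); last first.
  by rewrite -big_filter -[RHS]big_filter enumT.
have -> : blade A = blade [set i in enum 'I_n | i \in A].
  by congr blade; apply/setP => i; rewrite !inE mem_enum.
elim: (enum 'I_n) srt => [|i s IHs] srt.
  by rewrite big_nil; congr blade; apply/setP => i; rewrite !inE.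
have lt_i (j : 'I_n) : j \in s -> (i < j)%N.
  have ltT : transitive (fun i j : 'I_n => (i < j)%N).
    by move=> ? ? ?; apply: ltn_trans.
  by move: j; apply/allP; apply: (order_path_min ltT).
rewrite big_cons -IHs ?(path_sorted srt)//; case: ifP => iA; last first.
  congr blade; apply/setP => j; rewrite !inE.
  by case: eqP => // ->; rewrite iA !andbF.
rewrite blade_mul /csign big_set1 big1 ?scale1r; last first.
  by move=> j; rewrite inE => /andP[/lt_i]; rewrite ltnNge => /negPf->.
congr blade; apply/setP => j; rewrite !inE.
case: eqP => [->|_] /=; last by [].
by rewrite iA andbT; case: (boolP (i \in s)) => // /lt_i; rewrite ltnn.
Qed.

End Clifford.

(* Polynomials with Clifford coefficients, in which the variables are central:
   this ring is R[x] (x) Cl_(0,n). *)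
Notation cpoly R n := {mpoly (clifford R n)[n]}.

Section Umbral.
Context (R : comNzRingType) (n : nat).
Local Notation Rx := {mpoly R[n]}.
Local Notation operator := {linear Rx -> Rx}.

Definition translate (y : 'I_n -> R) (f : Rx) : Rx :=
  f \mPo [tuple 'X_i + (y i)%:MP | i < n].

Definition shift_invariant (T : operator) : Prop :=
  forall (y : 'I_n -> R) (f : Rx), T (translate y f) = translate y (T f).

Definition delta_operator (O : 'I_n -> operator) : Prop :=
  (forall j, shift_invariant (O j)) /\
  exists2 c : R, c != 0 & forall j k, O j 'X_k = (c *+ (j == k))%:MP.

Definition commutator (S T : operator) (f : Rx) : Rx := S (T f) - T (S f).

Definition weyl_heisenberg (O x' : 'I_n -> operator) : Prop :=
  forall j k,
  [/\ forall f, commutator (O j) (O k) f = 0,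
       forall f, commutator (x' j) (x' k) f = 0
     & forall f, commutator (O j) (x' k) f = f *+ (j == k)].

(* The elementary tensor f (x) a. *)
Definition tensor (f : Rx) (a : clifford R n) : cpoly R n :=
  a *: map_mpoly (in_alg (clifford R n)) f.

(* The operator T (x) id, i.e. T acting on the polynomial factor; see
   on_polyD and on_poly_tensor. *)
Definition on_poly (T : operator) (F : cpoly R n) : cpoly R n :=
  \sum_(m <- msupp F) tensor (T 'X_[m]) F@_m.

Lemma mcoeff_tensor f a m : (tensor f a)@_m = f@_m *: a.
Proof. by rewrite /tensor mcoeffZ mcoeff_map_mpoly /= -scalerAr mulr1. Qed.

Lemma tensor0r f : tensor f 0 = 0.
Proof. by rewrite /tensor scale0r. Qed.

Lemma tensorDr f a b : tensor f (a + b) = tensor f a + tensor f b.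
Proof. by rewrite /tensor scalerDl. Qed.

Lemma tensor0l a : tensor 0 a = 0.
Proof. by rewrite /tensor raddf0 scaler0. Qed.

Lemma tensorDl f g a : tensor (f + g) a = tensor f a + tensor g a.
Proof. by rewrite /tensor raddfD scalerDr. Qed.

Lemma tensorZ c f a : tensor (c *: f) a = tensor f (c *: a).
Proof.
by rewrite /tensor map_mpolyZ scalerA /= -scalerAr mulr1.
Qed.

Lemma on_polyE (T : operator) (F : cpoly R n) k : (msize F <= k)%N ->
  on_poly T F = \sum_(m : 'X_{1..n < k}) tensor (T 'X_[m]) F@_m.
Proof.
move=> Fk; pose I : subFinType _ := 'X_{1..n < k}.
rewrite /on_poly (big_mksub I) //=; first last.
  by move=> m /msize_mdeg_lt /leq_trans; apply.
  by rewrite msupp_uniq.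
by rewrite big_rmcond //= => m /memN_msupp_eq0 ->; rewrite tensor0r.
Qed.

Lemma on_polyD T : {morph on_poly T : F G / F + G}.
Proof.
move=> F G; pose k := maxn (maxn (msize F) (msize G)) (msize (F + G)).
rewrite !(@on_polyE T _ k) ?leq_max ?leqnn ?orbT //.
by rewrite -big_split; apply: eq_bigr => m _; rewrite mcoeffD tensorDr.
Qed.

Lemma on_poly_tensor T f a : on_poly T (tensor f a) = tensor (T f) a.
Proof.
pose k := maxn (msize f) (msize (tensor f a)).
rewrite (@on_polyE T _ k) ?leq_maxr //.
have -> : T f = \sum_(m : 'X_{1..n < k}) f@_m *: T 'X_[m].
  rewrite {1}(@mpolywE n R k f) ?leq_maxl // linear_sum.
  by apply: eq_bigr => m _; rewrite linearZ.
rewrite (big_morph (fun g => tensor g a) (id1 := 0) (op1 := +%R)); first last.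
- exact: tensor0l.
- by move=> f1 f2; apply: tensorDl.
by apply: eq_bigr => m _; rewrite tensorZ; congr tensor; apply: mcoeff_tensor.
Qed.

Definition umbral_euler (O x' : 'I_n -> operator) (F : cpoly R n) : cpoly R n :=
  \sum_(j < n) on_poly (x' j) (on_poly (O j) F).

End Umbral.

(* Main.v *)
Require Import Defs.
From HB Require Import structures.
From mathcomp Require Import all_boot all_order all_algebra.
From mathcomp Require Import reals.
From mathcomp Require Import mpoly.

(** The idea is to commute [E = \sum_j x'_j O_j] past the lowering operators:
    the Weyl-Heisenberg relations give
      [O_j (E + s) = (E + (s + 1)) O_j]   (lower_euler),
    while each [O_j] lowers the degree (msize_delta_operator).  So [E + s] can
    be inverted on polynomials by induction on the degree, for all [s > 0] at
    once.
    - Injectivity: if [(E + s) f = 0] then [O_j f] is killed by [E + (s + 1)],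
      hence vanishes; then [E f = 0], and [s f = 0].
    - Surjectivity: given [g], let [h_j] be the preimage of [O_j g] under
      [E + (s + 1)].  A solution of [(E + s) f = g] must satisfy [O_j f = h_j],
      so it can only be [f = s^-1 (g - \sum_k x'_k h_k)].  This [f] is a
      solution because the integrability condition [O_j h_k = O_k h_j] holds:
      both sides have the same image [O_j O_k g] under [E + (s + 2)].

    That a delta operator lowers the degree comes from Taylor expansion:
    comparing the coefficients of [t] in [T (f (x + t e_i)) = (T f) (x + t e_i)]
    shows that a shift-invariant [T] commutes with the partial derivatives.  As
    [O_j] kills constants, degrees drop by induction, a polynomial being of
    degree at most [d + 1] as soon as its partial derivatives are of degree at
    most [d].

    Finally [E + s] acts on Clifford-valued polynomials through the scalar
    factor only, so if [G] inverts it on scalar polynomials then [G] acting on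
    the polynomial factor is an inverse there; it suffices to check this on
    elementary tensors, which additively generate the whole ring. *)

Set Implicit Arguments.
Unset Strict Implicit.
Unset Printing Implicit Defensive.

Import Order.TTheory GRing.Theory Num.Theory.
Local Open Scope ring_scope.

Section WeylEuler.
Context {K : fieldType} {V : lmodType K} {n : nat}.
Context {O x' : 'I_n -> {linear V -> V}} {deg : V -> nat}.
Context (O_comm : forall j k f, O j (O k f) = O k (O j f))
  (O_x' : forall j k f, O j (x' k f) = x' k (O j f) + f *+ (j == k))
  (deg_eq0 : forall f, deg f = 0%N -> f = 0)
  (deg_O : forall d j f, (deg f <= d.+1)%N -> (deg (O j f) <= d)%N).

Local Notation euler f := (\sum_j x' j (O j f)).

Lemma lower_sum j (h : 'I_n -> V) :
  O j (\sum_k x' k (h k)) = \sum_k x' k (O j (h k)) + h j.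
Proof.
rewrite linear_sum /=; under eq_bigr do rewrite O_x'.
rewrite big_split /=; congr (_ + _).
rewrite (bigD1 j) //= eqxx big1 ?addr0 // => k kj.
by rewrite eq_sym (negPf kj).
Qed.

(** The commutation [O_j (E + s) = (E + (s + 1)) O_j] trades a shift of [s] for
    a lower degree, which is what drives both inductions below. *)
Lemma lower_euler s j f :
  O j (euler f + s *: f) = euler (O j f) + (s + 1) *: O j f.
Proof.
rewrite linearD linearZ /= lower_sum scalerDl scale1r [s *: _ + _]addrC addrA.
by do 2!congr (_ + _); apply: eq_bigr => k _; rewrite O_comm.
Qed.

(** The condition on [s] is stable under [s |-> s + 1], so that the induction
    on the degree can be run for all such [s] simultaneously. *)
Lemma euler_shift_inj s : (forall k, s + k%:R != 0) ->
  forall f, euler f + s *: f = 0 -> f = 0.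
Proof.
move=> s_nz f; have [d] := ubnPleq (deg f).
elim: d s s_nz f => [|d IHd] s s_nz f fd Ef.
  by apply: deg_eq0; apply/eqP; rewrite -leqn0.
have Of j : O j f = 0.
  apply: (IHd (s + 1)) => [k||]; first by rewrite -addrA nat1r.
  - exact: deg_O.
  - by rewrite -lower_euler Ef linear0.
move: Ef; rewrite big1 ?add0r => [/eqP|j _]; last by rewrite Of linear0.
by rewrite scaler_eq0 -[s]addr0 (negPf (s_nz 0%N)) => /eqP.
Qed.

(** [f] is recovered from the would-be values [h j] of [O j f]; that these are
    compatible is forced by injectivity. *)
Lemma euler_shift_surj s : (forall k, s + k%:R != 0) ->
  forall g, exists f, euler f + s *: f = g.
Proof.
move=> s_nz g; have [d] := ubnPleq (deg g).
elim: d s s_nz g => [|d IHd] s s_nz g gd.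
  exists 0; rewrite scaler0 addr0 big1 => [|j _]; last by rewrite !linear0.
  by apply/esym/deg_eq0/eqP; rewrite -leqn0.
have s1_nz k : s + 1 + k%:R != 0 by rewrite -addrA nat1r.
have s2_nz k : s + 1 + 1 + k%:R != 0 by rewrite -addrA nat1r.
have s0 : s != 0 by rewrite -[s]addr0 (s_nz 0%N).
have /fin_all_exists[h Eh] j : exists h, euler h + (s + 1) *: h = O j g.
  by apply: IHd => //; apply: deg_O.
(* Both sides are mapped to O j (O k g) by E + (s + 2). *)
have hC j k : O j (h k) = O k (h j).
  apply/eqP; rewrite -subr_eq0; apply/eqP/(euler_shift_inj s2_nz).
  have eulerB u v : euler (u - v) = euler u - euler v.
    by rewrite -sumrB; apply: eq_bigr => i _; rewrite !linearB.
  by rewrite eulerB scalerBr addrACA -opprD -!lower_euler !Eh O_comm subrr.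
exists (s^-1 *: (g - \sum_k x' k (h k))).
have Of j : O j (s^-1 *: (g - \sum_k x' k (h k))) = h j.
  rewrite linearZ linearB /= -Eh lower_sum; under eq_bigr do rewrite hC.
  by rewrite scalerDl scale1r addrCA addrK scalerA mulVf ?scale1r.
by rewrite scalerA mulfV // scale1r; under eq_bigr do rewrite Of;
  rewrite addrC subrK.
Qed.
End WeylEuler.

Lemma coef1M (R : nzRingType) (p q : {poly R}) :
  (p * q)`_1 = p`_0 * q`_1 + p`_1 * q`_0.
Proof. by rewrite coefM 2!big_ord_recl big_ord0 addr0. Qed.

Section Taylor.
Context {R : comNzRingType} {n : nat}.
Local Notation Rx := {mpoly R[n]}.

(** The translation by [t e_i] with [t] kept formal, as a polynomial in [t]. *)
Definition taylor (i : 'I_n) : Rx -> {poly Rx} :=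
  mmap (polyC \o @mpolyC n R) (fun j => ('X_j)%:P + 'X *+ (j == i)).

Lemma taylor_horner i f t :
  (taylor i f).[t%:MP] = translate (fun j => t *+ (j == i)) f.
Proof.
rewrite /translate comp_mpolyE /taylor /mmap horner_sum; apply: eq_bigr => m _.
rewrite hornerM hornerC mul_mpolyC /mmap1 horner_prod; congr (_ *: _).
apply: eq_bigr => j _; rewrite tnth_mktuple horner_exp hornerD hornerC.
by rewrite hornerMn hornerX mpolyCMn.
Qed.

(** Only the coefficient of [t] is needed later, but the constant one enters
    the Leibniz rule when the two are propagated through products. *)
Lemma taylor_coef01 i f : (taylor i f)`_0 = f /\ (taylor i f)`_1 = f^`M(i).
Proof.
pose P (g : Rx) := (taylor i g)`_0 = g /\ (taylor i g)`_1 = g^`M(i).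
have P1 : P 1.
  by rewrite /P /taylor rmorph1 !coef1 -mpolyC1 mderivC.
have PM g h : P g -> P h -> P (g * h).
  have -> : P (g * h) = ((taylor i g * taylor i h)`_0 = g * h /\
      (taylor i g * taylor i h)`_1 = (g * h)^`M(i)).
    by rewrite -[taylor i g * _](rmorphM (mmap _ _)).
  (* From here on only the two lowest coefficients of both factors matter. *)
  rewrite /P; move: (taylor i g) (taylor i h) => p q [p0 p1] [q0 q1].
  by rewrite coef0M coef1M p0 p1 q0 q1 mderivM addrC.
have PX j : P 'X_j.
  rewrite /P /taylor mmapX mmap1U !coefD !coefC !coefMn !coefX /=.
  rewrite mul0rn addr0 add0r; split=> //.
  rewrite mderivX mnm1E eq_sym; case: eqP => [->|_] /=.
    by rewrite -{1}[U_(j)%MM]add0m addmK mpolyX0 scale1r mulr1n.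
  by rewrite scale0r.
elim/mpolyind: f => [|c m p _ _ [IH0 IH1]].
  by rewrite /taylor mmap0 !coef0 mderiv0.
have [X0 X1] : P 'X_[m].
  rewrite mpolyXE_id; apply: big_ind => // j _.
  by elim: (m j) => [|k IHk]; rewrite ?expr0 // exprS; apply: PM.
have -> : taylor i (c *: 'X_[m] + p) =
    c%:MP%:P * taylor i 'X_[m] + taylor i p by rewrite /taylor mmapD mmapZ.
move: (taylor i 'X_[m]) (taylor i p) X0 X1 IH0 IH1 => q r q0 q1 r0 r1.
by rewrite !coefD !coefCM q0 q1 r0 r1 mderivD mderivZ !mul_mpolyC.
Qed.
End Taylor.

Section Delta.
Context {R : numFieldType} {n : nat}.
Local Notation Rx := {mpoly R[n]}.

(** Two polynomials in [t] that agree at all constants agree, because the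
    constants form an infinite subset of the domain of coefficients. *)
Lemma poly_mpolyC_eq (p q : {poly Rx}) :
  (forall t : R, p.[t%:MP] = q.[t%:MP]) -> p = q.
Proof.
move=> pq; apply/eqP; rewrite -subr_eq0; apply/eqP.
pose rs := [seq (k%:R : Rx) | k <- iota 0 (size (p - q))].
apply: (@roots_geq_poly_eq0 _ _ rs); last by rewrite size_map size_iota.
- apply/allP=> _ /mapP[k _ ->]; rewrite /root hornerD hornerN.
  by rewrite -mpolyC_nat pq subrr.
- rewrite map_inj_uniq ?iota_uniq // => k l /(congr1 (mcoeff 0%MM)).
  by rewrite -!mpolyC_nat !mcoeffC eqxx !mulr1 => /eqP; rewrite eqr_nat => /eqP.
Qed.

(** Shift-invariance only concerns scalar translations, but both sides are
    polynomial in the length [t] of the translation, so their coefficients of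
    [t] can be compared. *)
Lemma shift_invariant_mderiv (T : {linear Rx -> Rx}) i f :
  shift_invariant T -> T (f^`M(i)) = (T f)^`M(i).
Proof.
move=> Tinv.
have TE : map_poly T (taylor i f) = taylor i (T f).
  apply: poly_mpolyC_eq => t; rewrite taylor_horner -Tinv -taylor_horner.
  rewrite (horner_coef_wide _ (size_poly _ _)) horner_coef linear_sum /=.
  apply: eq_bigr => k _; rewrite coef_map_id0 ?linear0 //.
  by rewrite mulrC [_ * t%:MP ^+ k]mulrC -!rmorphXn !mul_mpolyC linearZ.
rewrite -(taylor_coef01 i f).2 -(taylor_coef01 i (T f)).2 -TE.
by rewrite coef_map_id0 ?linear0.
Qed.

(** A monomial of positive degree survives, in characteristic zero, in the
    derivative along any variable that occurs in it. *)
Lemma msize_mderiv (f : Rx) d :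
  (forall i, (msize f^`M(i) <= d)%N) -> (msize f <= d.+1)%N.
Proof.
move=> fd; rewrite msizeE; apply/bigmax_leqP_seq => m mf _.
rewrite ltnS leqNgt; apply/negP => dm.
have [i mi] : exists i, (0 < m i)%N.
  apply/existsP; apply: contraLR dm; rewrite negb_exists => /forallP m0.
  by rewrite mdegE big1 // => i _; apply/eqP; rewrite -leqn0 leqNgt m0.
have mE : (m - U_(i) + U_(i))%MM = m by rewrite submK // lep1mP -lt0n.
have /msize_mdeg_ge : (msize f^`M(i) <= mdeg (m - U_(i))%MM)%N.
  by apply: leq_trans (fd i) _; rewrite -ltnS -[ltnRHS]addn1 -(mdeg1 i) -mdegD mE.
move=> /memN_msupp_eq0/eqP; rewrite mcoeff_mderiv mE mulrn_eq0 /= mcoeff_eq0.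
by rewrite mf.
Qed.

(** Translating ['X_j] by 1 adds [O_j 1] to [O_j 'X_j]; but [O_j 'X_j] is constant,
    so that it cannot change. *)
Lemma delta_operator1 (O : 'I_n -> {linear Rx -> Rx}) j :
  delta_operator O -> O j 1 = 0.
Proof.
move=> [Oinv [c _ OX]]; have := Oinv j (fun=> 1) 'X_j.
rewrite /translate comp_mpolyXU -tnth_nth tnth_mktuple OX comp_mpolyC.
by rewrite linearD /= OX => /eqP; rewrite -subr_eq0 addrC addKr mpolyC1 => /eqP.
Qed.

Lemma msize_mderiv_le i (f : Rx) d :
  (msize f <= d.+1)%N -> (msize f^`M(i) <= d)%N.
Proof.
move=> fd; rewrite msizeE; apply/bigmax_leqP_seq => m mf _.
rewrite -ltnS; apply: leq_trans fd; rewrite -[X in (X < _)%N]addn1 -(mdeg1 i) -mdegD.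
apply: msize_mdeg_lt; apply: contraLR mf; rewrite -!mcoeff_eq0 mcoeff_mderiv.
by move/eqP->; rewrite mul0rn.
Qed.

(** Induction on the degree through the partial derivatives, with which [O_j]
    commutes; constants are the base case. *)
Lemma msize_delta_operator (O : 'I_n -> {linear Rx -> Rx}) d j f :
  delta_operator O -> (msize f <= d.+1)%N -> (msize (O j f) <= d)%N.
Proof.
move=> Odelta; elim: d f => [|d IHd] f fd.
  rewrite [f]msize1_polyC // -[_%:MP]mulr1 mul_mpolyC linearZ /=.
  by rewrite delta_operator1 // scaler0 msize0.
apply: msize_mderiv => i.
by rewrite -shift_invariant_mderiv ?IHd ?msize_mderiv_le //; case: Odelta.
Qed.
End Delta.

(** The inverse has to come as a bundled linear map, for that is what can be
    extended to Clifford-valued polynomials. *)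
Lemma linear_inverse (K : nzRingType) (V : lmodType K) (T : V -> V) :
  linear T -> (forall f, T f = 0 -> f = 0) -> (forall g, exists f, T f = g) ->
  exists G : {linear V -> V}, cancel T G /\ cancel G T.
Proof.
move=> linT injT surjT.
pose L : {linear V -> V} :=
  HB.pack T (GRing.isLinear.Build K V V *:%R T linT).
have T_inj : injective T.
  move=> f g Tfg; apply/eqP; rewrite -subr_eq0; apply/eqP/injT.
  by rewrite -[T _]/(L (f - g)) linearB /= Tfg subrr.
have surjTb g : exists f, T f == g by have [f <-] := surjT g; exists f.
pose G g := xchoose (surjTb g).
have GK : cancel G T by move=> g; apply/eqP/(xchooseP (surjTb g)).
have linG : linear G by move=> c f g; apply: T_inj; rewrite linT !GK.
pose LG : {linear V -> V} :=
  HB.pack G (GRing.isLinear.Build K V V *:%R G linG).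
exists LG.
by split=> // f; apply: T_inj; rewrite GK.
Qed.

Section OnPoly.
Context {R : comNzRingType} {n : nat}.
Local Notation Rx := {mpoly R[n]}.

Lemma eq_on_tensor (S T : cpoly R n -> cpoly R n) :
  {morph S : F G / F + G} -> {morph T : F G / F + G} ->
  (forall f a, S (tensor f a) = T (tensor f a)) -> S =1 T.
Proof.
move=> SD TD ST; elim/mpolyind => [|a m F _ _ IH].
  by rewrite -(tensor0r (0 : Rx)).
have -> : a *: 'X_[m] = tensor ('X_[m] : Rx) a by rewrite /tensor map_mpolyX.
by rewrite SD TD ST IH.
Qed.

Lemma scale_tensor (s : R) f (a : clifford R n) :
  s%:A *: tensor f a = tensor (s *: f) a.
Proof. by rewrite tensorZ /tensor scalerA mulr_algl. Qed.

Lemma umbral_euler_tensor (O x' : 'I_n -> {linear Rx -> Rx}) f a :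
  umbral_euler O x' (tensor f a) = tensor (\sum_j x' j (O j f)) a.
Proof.
rewrite (big_morph (fun g => tensor g a) (id1 := 0) (op1 := +%R)); first last.
- exact: tensor0l.
- by move=> f1 f2; apply: tensorDl.
by apply: eq_bigr => j _; rewrite !on_poly_tensor.
Qed.

Lemma umbral_eulerD (O x' : 'I_n -> {linear Rx -> Rx}) :
  {morph umbral_euler O x' : F G / F + G}.
Proof.
move=> F G; rewrite /umbral_euler -big_split; apply: eq_bigr => j _ /=.
by rewrite !on_polyD.
Qed.
End OnPoly.

Unset Implicit Arguments.

Theorem lemma3p3 (R : realType) (n : nat) (n_ge1 : (1 <= n)%N)
    (O x' : 'I_n -> {linear {mpoly R[n]} -> {mpoly R[n]}})
    (O_delta : delta_operator O) (O_x'_WH : weyl_heisenberg O x')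
    (s : R) (s_gt0 : 0 < s) :
  exists I_s : cpoly R n -> cpoly R n,
    (forall F, umbral_euler O x' (I_s F) + s%:A *: I_s F = F) /\
    (forall F, I_s (umbral_euler O x' F + s%:A *: F) = F).
Proof.
have s_nz k : s + k%:R != 0 by rewrite gt_eqF // ltr_wpDr.
have O_comm j k f : O j (O k f) = O k (O j f).
  by case: (O_x'_WH j k) => /(_ f)/subr0_eq.
have O_x' j k f : O j (x' k f) = x' k (O j f) + f *+ (j == k).
  by case: (O_x'_WH j k) => _ _ /(_ f) <-; rewrite addrC subrK.
have deg_eq0 (f : {mpoly R[n]}) : msize f = 0%N -> f = 0.
  by move/eqP; rewrite msize_poly_eq0 => /eqP.
have deg_O d j f := @msize_delta_operator R n O d j f O_delta.
pose T f := \sum_j x' j (O j f) + s *: f.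
have linT : linear T.
  move=> c f g; rewrite /T !scalerDr addrACA scaler_sumr -big_split /=.
  congr (_ + _); last by rewrite !scalerA mulrC.
  by apply: eq_bigr => j _; rewrite !linearP.
have [G [TK GK]] := linear_inverse linT
  (euler_shift_inj O_comm O_x' deg_eq0 deg_O s_nz)
  (euler_shift_surj O_comm O_x' deg_eq0 deg_O s_nz).
pose TP F := umbral_euler O x' F + s%:A *: F.
have TPD : {morph TP : F1 F2 / F1 + F2}.
  by move=> F1 F2; rewrite /TP umbral_eulerD scalerDr addrACA.
have TP_tensor f a : TP (tensor f a) = tensor (T f) a.
  by rewrite /TP umbral_euler_tensor scale_tensor -tensorDl.
have TG : TP \o on_poly G =1 id.
  apply: eq_on_tensor => [F1 F2|F1 F2|f a]; last 1 first.
  - by rewrite /= on_poly_tensor TP_tensor GK.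
  - by rewrite /= on_polyD TPD.
  - by [].
have GT : on_poly G \o TP =1 id.
  apply: eq_on_tensor => [F1 F2|F1 F2|f a]; last 1 first.
  - by rewrite /= TP_tensor on_poly_tensor TK.
  - by rewrite /= TPD on_polyD.
  - by [].
by exists (on_poly G).
Qed.
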